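(* Let $W=\{(W_i,\omega_i)\}_{i\in I}$ be a fusion frame for a separable Hilbert space $\mathcal{H}$ such that $\dim W_i<\infty$ for all $i\in I$. Let $\{e_j\}_{j\in J}$ be an orthonormal basis for $\mathcal{H}$ and let $\mathcal{F}_W=\{\omega_i\pi_{W_i}e_j\}_{i\in I,\,j\in J}$. Then $$e(\mathcal{F}_W)+\sum_{i\in I}\dim W_i=|I|\dim\mathcal{H}+e(W).$$ In particular, if $\dim\mathcal{H}<\infty$ (in which case $|I|<\infty$ is assumed), then $e(\mathcal{F}_W)=(|I|-1)\dim\mathcal{H}$.
   Context: All index sets are countable. A family $W=\{(W_i,\omega_i)\}_{i\in I}$ of closed subspaces $W_i\subseteq\mathcal{H}$ and weights $\omega_i>0$ is a fusion frame for $\mathcal{H}$ if there are $0<A\le B<\infty$ with $A\|f\|^2\le\sum_{i\in I}\omega_i^2\|\pi_{W_i}f\|^2\le B\|f\|^2$ for all $f\in\mathcal{H}$, where $\pi_{W_i}$ is the orthogonal projection onto $W_i$. Whenever $\mathcal{H}$ is finite dimensional, fusion frames are assumed to have a finite index set. $\bigoplus_{i\in I}W_i$ denotes the Hilbert space of sequences $\{f_i\}_{i\in I}$ with $f_i\in W_i$ and $\sum_i\|f_i\|^2<\infty$. The synthesis operator is $T_W:\bigoplus_{i\in I}W_i\to\mathcal{H}$, $T_W\{f_i\}=\sum_i\omega_i f_i$, and the excess of $W$ is $e(W)=\dim N(T_W)$, where $N$ denotes the null space ($\infty$ if infinite dimensional). The family $\mathcal{F}_W$ is a frame for $\mathcal{H}$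 (a local frame of $W$). For an ordinary frame $\mathcal{F}=\{f_k\}_{k\in K}$, the excess $e(\mathcal{F})$ is the greatest integer $n$ such that $n$ elements can be removed from $\mathcal{F}$ leaving a complete set (or $\infty$ if there is no upper bound); equivalently $e(\mathcal{F})=\dim N(T_{\mathcal{F}})$, where $T_{\mathcal{F}}:\ell^2(K)\to\mathcal{H}$, $T_{\mathcal{F}}\{c_k\}=\sum_kc_kf_k$. Quantities are taken in $\{0,1,2,\dots\}\cup\{\infty\}$. *)

(* Defs.v *)
From HB Require Import structures.
From mathcomp Require Import all_boot all_order all_algebra.
From mathcomp Require Import finmap complex.
From mathcomp Require Import all_classical all_reals all_analysis.
From mathcomp.analysis.showcase Require summability.
Import Order.TTheory GRing.Theory Num.Theory.
Import numFieldNormedType.Exports.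

Set Implicit Arguments.
Unset Strict Implicit.
Unset Printing Implicit Defensive.

Local Open Scope classical_set_scope.
Local Open Scope ring_scope.

(* A Hilbert space is encoded as a [completeNormedModType] over its scalars
   together with an inner product [dot] (linear in its first argument) such that
   [`|x| ^+ 2 = dot x x].  Norms, weights and frame bounds are elements of the
   scalar field; in R[i] the order makes every positive element real. *)

Variant scalar_kind := RealScalars | ComplexScalars.

Definition scalars (R : realType) (k : scalar_kind) : numFieldType :=
  match k with
  | RealScalars => R
  | ComplexScalars => R[i]
  end.

Definition scalar_conj (R : realType) (k : scalar_kind) :
    scalars R k -> scalars R k :=
  match k return scalars R k -> scalars R k with
  | RealScalars => id
  | ComplexScalars => @conjc R
  end.

Definition subspace (K : numFieldType) (V : lmodType K) (S : set V) : Prop :=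
  submod_closed [in S].

Definition lspan (K : numFieldType) (V : lmodType K) (X : set V) : set V :=
  smallest (@subspace K V) X.

Definition lin_indep (K : numFieldType) (V : lmodType K) (n : nat)
    (b : 'I_n -> V) : Prop :=
  forall c : 'I_n -> K, \sum_(i < n) c i *: b i = 0 -> forall i, c i = 0.

Definition is_basis (K : numFieldType) (V : lmodType K) (S : set V) (n : nat)
    (b : 'I_n -> V) : Prop :=
  lin_indep b /\ lspan (range b) = S.

(* [+oo] when [S] has no finite basis. *)
Definition vdim (R : realType) (K : numFieldType) (V : lmodType K)
    (S : set V) : \bar R :=
  xget +oo%E [set n%:R%:E | n in [set n | exists b : 'I_n -> V, is_basis S b]].

(* Sums over a countable index set are limits of finite partial sums along the
   net of finite subsets, that is, unconditional sums. *)
Definition has_sum (K : numFieldType) (V : normedModType K) (I : choiceType)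
    (x : I -> V) (s : V) : Prop :=
  summability.partial_sum x @ summability.totally --> s.

Definition complete_family (K : numFieldType) (H : normedModType K)
    (X : set H) : Prop :=
  closure (lspan X) = [set: H].

Definition separable_space (T : topologicalType) : Prop :=
  exists2 D : set T, countable D & dense D.

Definition orthonormal_basis (K : numFieldType) (H : normedModType K)
    (dot : H -> H -> K) (J : choiceType) (e : J -> H) : Prop :=
  (forall j j', dot (e j) (e j') = (j == j')%:R) /\ complete_family (range e).

(* The unique [y] in [W] with [x - y] orthogonal to [W]; the default value [0]
   is never used when [W] is a closed subspace of a Hilbert space. *)
Definition orthproj (K : numFieldType) (H : normedModType K)
    (dot : H -> H -> K) (W : set H) (x : H) : H :=
  xget 0 [set y | W y /\ forall z, W z -> dot (x - y) z = 0].

(* By convention, fusion frames for a finite dimensional space are finite. *)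
Definition is_fusion_frame (K : numFieldType) (H : normedModType K)
    (dot : H -> H -> K) (I : choiceType) (W : I -> set H) (w : I -> K) : Prop :=
  [/\ forall i, subspace (W i) /\ closed (W i),
      forall i, 0 < w i,
      (exists n (b : 'I_n -> H), is_basis [set: H] b) -> finite_set [set: I] &
      exists A B : K, [/\ 0 < A, A <= B &
        forall f : H, exists2 s : K,
          has_sum (fun i => w i ^+ 2 * `|orthproj dot (W i) f| ^+ 2 : K^o) s &
          A * `|f| ^+ 2 <= s <= B * `|f| ^+ 2]].

Definition direct_sum (K : numFieldType) (H : normedModType K)
    (I : choiceType) (W : I -> set H) : set (I -> H) :=
  [set f | (forall i, W i (f i)) /\
           exists s : K, has_sum (fun i => `|f i| ^+ 2 : K^o) s].

(* On [direct_sum W] the series converges as soon as the upper fusion frame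
   bound holds. *)
Definition fusion_synthesis (K : numFieldType) (H : normedModType K)
    (I : choiceType) (w : I -> K) (f : I -> H) : H :=
  summability.sum (fun i => w i *: f i).

Definition fusion_excess (R : realType) (K : numFieldType)
    (H : normedModType K) (I : choiceType) (W : I -> set H) (w : I -> K) :
    \bar R :=
  vdim R [set f | direct_sum W f /\ fusion_synthesis w f = 0].

Definition local_family (K : numFieldType) (H : normedModType K)
    (dot : H -> H -> K) (I J : choiceType) (W : I -> set H) (w : I -> K)
    (e : J -> H) (ij : I * J) : H :=
  w ij.1 *: orthproj dot (W ij.1) (e ij.2).

(* Elements are removed by index, so repeated vectors count with multiplicity. *)
Definition frame_excess (R : realType) (K : numFieldType)
    (H : normedModType K) (L : choiceType) (F : L -> H) : \bar R :=
  ereal_sup [set #|` E|%:R%:E | E in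
    [set E : {fset L} | complete_family (F @` ~` [set` E])]].

(* Main.v *)
From HB Require Import structures.
From mathcomp Require Import all_boot all_order all_algebra.
From mathcomp Require Import finmap complex.
From mathcomp Require Import all_classical all_reals all_analysis.
From mathcomp.analysis.showcase Require summability.
From mathcomp Require Import ring.
Require Import Defs.
Import Order.TTheory GRing.Theory Num.Theory.
Import numFieldNormedType.Exports.

Set Implicit Arguments.
Unset Strict Implicit.
Unset Printing Implicit Defensive.

Local Open Scope classical_set_scope.
Local Open Scope ring_scope.


(** The formula compares two dimension counts, and the two cases of its proof are
   the finite and the infinite orthonormal bases [e] of [H].

   The tool common to both is duality: by the projection theorem
   ([projection_exists]) a family is complete exactly when only [0] is orthogonal
   to it ([complete_familyP]).  The lower fusion frame bound says that only [0]
   is orthogonal to all the [W i] ([fusion_frame_separates]), and this makes the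
   local family complete ([local_family_complete]) and makes the vectors
   [w i *: b], for [b] in bases of the [W i], separate the points of [H].

   If [H] has finite dimension n, the index set I is finite.  A complete family
   of m vectors contains a basis of [H], and no set of fewer than n vectors is
   complete, so its excess is m - n ([frame_excess_finite]); the local family has
   m = |I| n.  The synthesis operator maps a space of dimension D, the sum of the
   [dim (W i)], onto [H], so rank-nullity gives the fusion excess D - n
   ([fusion_excess_finite]).  Then (|I| n - n) + D = |I| n + (D - n).

   If [H] has infinite dimension, both sides are infinite.  Finitely many nonzero
   [W i] would yield a finite family separating the points of [H], which bounds
   the size of linearly independent families ([separating_lin_indep_leq]).  Hence
   infinitely many [W i] are nonzero ([infinite_nonzero_components]); so I is
   infinite, and so is the sum of the dimensions.  The excesses contribute
   nonnegative amounts, that of the local family because it is complete. *)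

(** * Spans, bases and dimension *)

Section LinearAlgebra.
Variables (K : numFieldType) (V : lmodType K).
Implicit Types (S X : set V).

Lemma subspaceP S :
  subspace S <-> S 0 /\ forall a x y, S x -> S y -> S (a *: x + y).
Proof.
split=> -[S0 SD]; split.
- exact: set_mem S0.
- by move=> a x y Sx Sy; apply: set_mem (SD a x y _ _); exact: mem_set.
- exact: mem_set S0.
- by move=> a x y Sx Sy; apply: mem_set (SD a x y _ _); exact: set_mem.
Qed.

Lemma subspace_sum S (T : Type) (r : seq T) (P : pred T) (c : T -> K)
    (b : T -> V) :
  subspace S -> (forall t, S (b t)) -> S (\sum_(t <- r | P t) c t *: b t).
Proof.
move=> /subspaceP[S0 SD] Sb.
by apply: (big_rec (fun y => S y)) => // t y _ Sy; exact: SD.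
Qed.

Lemma subspace_lspan X : subspace (lspan X).
Proof.
apply/subspaceP; split=> [S [/subspaceP[S0 _] _] //|a x y hx hy S SX].
by have /subspaceP[_] := SX.1; apply; [exact: hx|exact: hy].
Qed.

Lemma lspan_range n (b : 'I_n -> V) :
  lspan (range b) = range (fun c : 'I_n -> K => \sum_i c i *: b i).
Proof.
apply/seteqP; split=> [|_ [c _ <-] S [subS bS]]; last first.
  by apply: subspace_sum => // i; apply: bS; exists i.
apply: smallest_sub.
  apply/subspaceP; split.
    by exists (fun=> 0) => //; rewrite big1// => i _; rewrite scale0r.
  move=> a _ _ [c _ <-] [d _ <-]; exists (fun i => a * c i + d i) => //.
  rewrite scaler_sumr -big_split; apply: eq_bigr => i _ /=.
  by rewrite scalerDl scalerA.
move=> _ [i _ <-]; exists (fun j => (j == i)%:R) => //.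
rewrite (bigD1 i)//= eqxx scale1r big1 ?addr0// => j /negbTE ->.
by rewrite scale0r.
Qed.

(** A matrix with more rows than columns has a nontrivial relation between its
   rows.  The columns of [A] stand for linear conditions on the combinations of
   the [c j] that together force such a combination to vanish. *)
Lemma lin_indep_leq m n (c : 'I_m -> V) (A : 'M[K]_(m, n)) :
  lin_indep c ->
  (forall v : 'rV_m, v *m A = 0 -> \sum_j v 0 j *: c j = 0) -> (m <= n)%N.
Proof.
move=> ind_c kerA; rewrite leqNgt; apply/negP => n_lt_m.
have /rowV0Pn[v] : kermx A != 0.
  rewrite -mxrank_eq0 mxrank_ker -lt0n subn_gt0.
  exact: leq_ltn_trans (rank_leq_col A) n_lt_m.
move=> /sub_kermxP vA0 /negP[]; apply/eqP/rowP => j; rewrite mxE.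
exact: ind_c (kerA _ vA0) j.
Qed.

Lemma basis_leq m n (b : 'I_n -> V) (c : 'I_m -> V) :
  lin_indep c -> (forall j, lspan (range b) (c j)) -> (m <= n)%N.
Proof.
move=> ind_c; rewrite lspan_range => /(_ _)/cid2 c_b.
pose A := \matrix_(j < m, i < n) s2val (c_b j) i.
apply: (lin_indep_leq (A := A) ind_c) => v vA0.
transitivity (\sum_j \sum_i (v 0 j * A j i) *: b i).
  apply: eq_bigr => j _; rewrite -{1}(s2valP' (c_b j)) scaler_sumr.
  by apply: eq_bigr => i _; rewrite scalerA !mxE.
rewrite exchange_big big1// => i _; rewrite -scaler_suml.
by have /rowP/(_ i) := vA0; rewrite !mxE => ->; rewrite scale0r.
Qed.

Lemma is_basis_mem S n (b : 'I_n -> V) i : is_basis S b -> S (b i).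
Proof. by move=> [_ <-] T [_]; apply; exists i. Qed.

Variable R : realType.

Lemma vdimE S n (b : 'I_n -> V) : is_basis S b -> vdim R S = n%:R%:E.
Proof.
move=> [ind_b Sb]; rewrite /vdim; case: xgetP => [_ -> [m [c [ind_c Sc]] <-]|];
  last by move=> /(_ n%:R%:E) []; exists n => //; exists b.
congr (_%:R%:E).
have Sbi i : S (b i) by exact: (@is_basis_mem S _ b).
have Sci i : S (c i) by exact: (@is_basis_mem S _ c).
apply/eqP; rewrite eqn_leq; apply/andP; split.
  by apply: (basis_leq ind_c (b := b)) => j; rewrite Sb.
by apply: (basis_leq ind_b (b := c)) => j; rewrite Sc.
Qed.

Lemma vdim_ge0 S : (0 <= vdim R S)%E.
Proof. by rewrite /vdim; case: xgetP => // _ -> [n _ <-]; rewrite lee_fin. Qed.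

Lemma vdim_lty S : (vdim R S < +oo)%E ->
  exists n (b : 'I_n -> V), is_basis S b /\ vdim R S = n%:R%:E.
Proof.
rewrite /vdim; case: xgetP => [_ -> [n [b Sb] <-] _|_]; last by rewrite ltxx.
by exists n, b.
Qed.

Lemma vdim_pinfty S : ~ (exists n (b : 'I_n -> V), is_basis S b) ->
  vdim R S = +oo%E.
Proof.
move=> S_inf; apply: contra_notP S_inf => /eqP; rewrite -ltey.
by case/vdim_lty => n [b [Sb _]]; exists n, b.
Qed.

Lemma finite_dim_bases (I : Type) (W : I -> set V) :
  (forall i, vdim R (W i) < +oo)%E ->
  exists (d : I -> nat) (B : forall i, 'I_(d i) -> V),
    forall i, is_basis (W i) (B i) /\ vdim R (W i) = (d i)%:R%:E.
Proof.
move=> finW; exists (fun i => projT1 (cid (vdim_lty (finW i)))).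
exists (fun i => projT1 (cid (projT2 (cid (vdim_lty (finW i)))))) => i.
exact: projT2 (cid (projT2 (cid (vdim_lty (finW i))))).
Qed.

End LinearAlgebra.

(** * Conjugation and infima of scalars *)

Section Scalars.
Variables (R : realType) (k : scalar_kind).
Local Notation K := (scalars R k).
Local Notation conj := (@scalar_conj R k).

Lemma scalar_conjK : involutive conj.
Proof. by case: k => //; exact: conjcK. Qed.

Lemma scalar_conj0 : conj 0 = 0.
Proof. by case: k => //; exact: rmorph0. Qed.

(** Nonnegative scalars are real also in the complex case, so completeness of
   the reals provides infima of squared distances within the scalar field. *)
Lemma scalar_inf (S : set K) : S !=set0 -> (forall s, S s -> 0 <= s) ->
  exists d, (forall s, S s -> d <= s) /\
            forall eps, 0 < eps -> exists2 s, S s & s < d + eps.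
Proof.
case: k S => /= S S0 S_ge0.
  have inf_S : has_inf S by split => //; exists 0.
  exists (inf S); split=> [s Ss|eps eps_gt0]; first exact: ge_inf inf_S.2 _ Ss.
  by have [s Ss] := inf_adherent eps_gt0 inf_S; exists s.
have reS s : S s -> s = (complex.Re s)%:C%C.
  by case: s => a b /S_ge0; rewrite lecE /= => /andP[/eqP->].
have inf_S : has_inf (@complex.Re R @` S).
  split; first by case: S0 => s Ss; exists (complex.Re s), s.
  by exists 0 => _ [s Ss <-]; have := S_ge0 _ Ss; rewrite lecE => /andP[].
exists (inf (@complex.Re R @` S))%:C%C; split=> [s Ss|[eps eps']].
  rewrite (reS _ Ss) lecR; apply: ge_inf; first exact: inf_S.2.
  by exists s.
rewrite ltcE /= => /andP[/eqP-> eps_gt0].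
have [_ [s Ss <-]] := inf_adherent eps_gt0 inf_S; exists s => //.
by rewrite (reS _ Ss) ltcE /= addr0 eqxx.
Qed.

End Scalars.

(** * Orthogonality and projections *)

Section Hilbert.
Variables (R : realType) (k : scalar_kind).
Local Notation K := (scalars R k).
Local Notation conj := (@scalar_conj R k).
Variables (H : completeNormedModType K) (dot : {dot H for conj}).
Hypothesis norm_dot : forall x : H, `|x| ^+ 2 = dot x x.
Implicit Types (x y z f : H) (M X : set H).

Lemma dotC x y : dot x y = conj (dot y x).
Proof. by rewrite (hermitian_subproof x y) expr0 mul1r. Qed.

Lemma dot_eq0C x y : dot x y = 0 -> dot y x = 0.
Proof. by rewrite dotC => /(congr1 conj); rewrite scalar_conjK scalar_conj0. Qed.

Lemma dotDl x y z : dot (x + y) z = dot x z + dot y z.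
Proof. exact: linearDl. Qed.

Lemma dotDr x y z : dot x (y + z) = dot x y + dot x z.
Proof. exact: linearDr. Qed.

Lemma dotBl x y z : dot (x - y) z = dot x z - dot y z.
Proof. exact: linearBl. Qed.

Lemma dotNr x y : dot x (- y) = - dot x y.
Proof. exact: linearNr. Qed.

Lemma dot0l x : dot 0 x = 0.
Proof. exact: linear0l. Qed.

Lemma dot0r x : dot x 0 = 0.
Proof. exact: linear0r. Qed.

Lemma dotZl a x y : dot (a *: x) y = a * dot x y.
Proof. exact: linearZl_LR. Qed.

Lemma dotZr a x y : dot x (a *: y) = conj a * dot x y.
Proof. exact: linearZr_LR. Qed.

Lemma dot_suml (T : Type) (r : seq T) (P : pred T) (c : T -> K) (b : T -> H) z :
  dot (\sum_(t <- r | P t) c t *: b t) z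
    = \sum_(t <- r | P t) c t * dot (b t) z.
Proof. by rewrite linear_sumlz; apply: eq_bigr => t _; exact: dotZl. Qed.

Lemma dot_norm_eq0 x : dot x x = 0 -> x = 0.
Proof. by rewrite -norm_dot => /eqP; rewrite sqrf_eq0 normr_eq0 => /eqP. Qed.

Lemma pythagoras x y : dot x y = 0 -> `|x + y| ^+ 2 = `|x| ^+ 2 + `|y| ^+ 2.
Proof.
move=> xy0; rewrite !norm_dot dotDl !dotDr xy0 (dot_eq0C xy0).
by rewrite addr0 add0r.
Qed.

Lemma parallelogram x y :
  `|x + y| ^+ 2 + `|x - y| ^+ 2 = (`|x| ^+ 2 + `|y| ^+ 2) *+ 2.
Proof.
rewrite !norm_dot dotDl dotBl !(dotDr x) !(dotDr y) !dotNr.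
ring.
Qed.

(** Pythagoras for the projection of [x] on the line through [z].  The bound
   [0 <= `|x - c *: z|] gives the Cauchy-Schwarz inequality; when [x] is nearly
   as short as all the vectors [x - c *: z], it shows that [x] is nearly
   orthogonal to [z]. *)
Lemma dot_gain x z : exists c : K,
  `|dot x z| ^+ 2 = `|z| ^+ 2 * (`|x| ^+ 2 - `|x - c *: z| ^+ 2).
Proof.
have [->|z_neq0] := eqVneq z 0.
  by exists 0; rewrite dot0r !normr0 expr0n /= mul0r.
have zz_neq0 : `|z| ^+ 2 != 0 by rewrite sqrf_eq0 normr_eq0.
set c := dot x z / `|z| ^+ 2; exists c.
have ort : dot (x - c *: z) (c *: z) = 0.
  by rewrite dotZr dotBl dotZl -norm_dot divfK// subrr mulr0.
have := pythagoras ort; rewrite subrK => ->; rewrite addrAC subrr add0r.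
rewrite normrZ normrM normfV normrX normr_id.
have -> : `|dot x z| / `|z| ^+ 2 * `|z| = `|dot x z| / `|z|.
  by rewrite expr2 invfM mulrA mulfVK ?normr_eq0.
by rewrite -exprMn mulrC divfK ?normr_eq0.
Qed.

Lemma cauchy_schwarz x z : `|dot x z| <= `|x| * `|z|.
Proof.
have [c dot_c] := dot_gain x z.
rewrite -(@ler_pXn2r _ 2) ?nnegrE ?mulr_ge0// dot_c exprMn mulrC.
by rewrite ler_wpM2r ?exprn_ge0// gerBl exprn_ge0.
Qed.

Lemma closureP X x :
  closure X x <-> forall eps : K, 0 < eps -> exists2 y, X y & `|x - y| < eps.
Proof.
split=> [clX eps eps_gt0|clX B /nbhs_ballP[eps /= eps_gt0 epsB]].
  have [y [Xy]] := clX _ (nbhsx_ballx x eps eps_gt0).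
  by rewrite -ball_normE => xy; exists y.
have [y Xy xy] := clX _ eps_gt0.
by exists y; split => //; apply: epsB; rewrite -ball_normE.
Qed.

Lemma subspace_closure X : subspace X -> subspace (closure X).
Proof.
move=> /subspaceP[X0 XD]; apply/subspaceP.
split=> [|a x y /closureP clx /closureP cly]; first exact: subset_closure.
apply/closureP => eps eps_gt0.
have a1_gt0 : 0 < `|a| + 1 by rewrite ltr_wpDl.
have e2_gt0 : 0 < eps / 2 by rewrite divr_gt0.
have [x' Xx' xx'] := clx (eps / 2 / (`|a| + 1)) (divr_gt0 e2_gt0 a1_gt0).
have [y' Xy' yy'] := cly _ e2_gt0.
exists (a *: x' + y'); first exact: XD.
rewrite opprD addrACA -scalerBr.
apply: le_lt_trans (ler_normD _ _) _; rewrite normrZ [ltRHS]splitr.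
apply: ler_ltD => //; apply: (@le_trans _ _ ((`|a| + 1) * `|x - x'|)).
  by rewrite ler_wpM2r// lerDl ler01.
by rewrite mulrC -ler_pdivlMr// ltW.
Qed.

(** The point of [M] nearest to [x]: by the parallelogram law, points of [M] that
   nearly realize the distance to [x] are close to each other, so the filter
   generated by the sets of such points is Cauchy.  Its limit inherits the
   orthogonality to [M] that [dot_gain] gives approximately for near-minimizers. *)
Lemma projection_exists M : subspace M -> closed M -> forall x,
  exists y, M y /\ forall z, M z -> dot (x - y) z = 0.
Proof.
move=> subM clM x.
have [M0 MD] := (subspaceP M).1 subM.
pose S := [set `|x - y| ^+ 2 | y in M].
have [|_ [y _ <-]|d [d_le d_inf]] := @scalar_inf R k S.
- by exists (`|x - 0| ^+ 2), 0.
- exact: exprn_ge0.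
pose near_min (eps : K) := [set y | M y /\ `|x - y| ^+ 2 < d + eps].
pose F := filter_from [set eps : K | 0 < eps] near_min.
have FF : ProperFilter F.
  apply: filter_from_proper; last first.
    by move=> eps /d_inf[_ [y My <-] y_lt]; exists y.
  apply: filter_from_filter; first by exists 1 => /=.
  have le_e e1 e2 : e1 <= e2 -> near_min e1 `<=` near_min e2.
    move=> le12 y [My y_lt]; split=> //.
    by apply: lt_le_trans y_lt _; rewrite lerD2l.
  move=> e1 e2 /= e1_gt0 e2_gt0.
  have /orP[le12|le21] := real_leVge (gtr0_real e1_gt0) (gtr0_real e2_gt0).
    by exists e1 => // y hy; split=> //; exact: le_e le12 _ hy.
  by exists e2 => // y hy; split=> //; exact: le_e le21 _ hy.
(* The midpoint of [y] and [y'] lies in [M]. *)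
have dle y y' : M y -> M y' -> d *+ 4 <= `|(x - y) + (x - y')| ^+ 2.
  move=> My My'; pose m := 2^-1 *: (y + y').
  have Mm : M m.
    by rewrite /m -[_ *: _]addr0; apply: (MD) => //; rewrite -[y]scale1r; apply: MD.
  have -> : (x - y) + (x - y') = 2 *: (x - m).
    rewrite scalerBr /m scalerA divff ?pnatr_eq0// scale1r.
    by rewrite scaler_nat addrACA -opprD mulr2n.
  rewrite normrZ exprMn normr_nat -natrX mulr_natl lerMn2r/=.
  by apply: d_le; exists m.
have cauchyF : cauchy F.
  apply/cauchy_ballP => e e_gt0.
  have e2_gt0 : 0 < (e / 2) ^+ 2 by rewrite exprn_gt0// divr_gt0.
  exists (near_min ((e / 2) ^+ 2), near_min ((e / 2) ^+ 2)).
    by split; exists ((e / 2) ^+ 2).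
  move=> [y y'] /= [[My y_lt] [My' y'_lt]].
  rewrite -ball_normE /= -(@ltr_pXn2r _ 2) ?nnegrE ?(ltW e_gt0)//.
  have -> : y - y' = - ((x - y) - (x - y')).
    by rewrite opprB opprB [RHS]addrC addrA subrK.
  rewrite normrN -(ltrD2l (`|(x - y) + (x - y')| ^+ 2)) parallelogram.
  have := ltrD y_lt y'_lt; rewrite -(ltr_pMn2r (n := 2))// => /lt_le_trans; apply.
  have -> : (d + (e / 2) ^+ 2 + (d + (e / 2) ^+ 2)) *+ 2 = d *+ 4 + e ^+ 2.
    rewrite -mulr2n -mulrnA mulrnDl expr_div_n -natrX -[X in _ + X]mulr_natr.
    by rewrite divfK ?pnatr_eq0.
  by rewrite lerD2r; exact: dle.
have [y Fy] : exists y, F --> y by apply/cvg_ex; exact: cauchy_cvg.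
have approx e : 0 < e ->
    exists y', [/\ M y', `|x - y'| ^+ 2 < d + e ^+ 2 & `|y - y'| < e].
  move=> e_gt0.
  have Fe : F (near_min (e ^+ 2)) by exists (e ^+ 2) => //=; rewrite exprn_gt0.
  have [y' [[My' y'_lt]]] := filter_ex (filterI Fe (Fy _ (nbhsx_ballx y e e_gt0))).
  by rewrite -ball_normE; exists y'.
exists y; split.
  rewrite ((closure_id M).1 clM); apply/closureP => eps /approx[y' [My' _ ?]].
  by exists y'.
move=> z Mz; apply/eqP; rewrite -normr_le0; apply/ler_addgt0Pr => eps eps_gt0.
have z1_gt0 : 0 < `|z| *+ 2 + 1 by rewrite ltr_wpDl// mulrn_wge0.
have [e e_gt0 e_le] : exists2 e, 0 < e & e * `|z| + e * `|z| <= eps.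
  exists (eps / (`|z| *+ 2 + 1)); first exact: divr_gt0.
  rewrite -mulrDr -mulr2n mulrAC ler_pdivrMr// ler_wpM2l ?(ltW eps_gt0)//.
  by rewrite lerDl.
have [y' [My' y'_lt yy']] := approx e e_gt0.
have near_orth : `|dot (x - y') z| <= e * `|z|.
  have [c dot_c] := dot_gain (x - y') z.
  rewrite -(@ler_pXn2r _ 2) ?nnegrE ?mulr_ge0 ?(ltW e_gt0)// dot_c exprMn mulrC.
  rewrite ler_wpM2r ?exprn_ge0// lerBlDr; apply: le_trans (ltW y'_lt) _.
  rewrite addrC lerD2l; apply: d_le; exists (y' + c *: z).
    by rewrite addrC; exact: MD.
  by rewrite opprD addrA.
have -> : x - y = (x - y') - (y - y') by rewrite opprB addrA subrK.
rewrite dotBl; apply: le_trans (ler_normB _ _) _; rewrite add0r.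
apply: le_trans e_le; apply: lerD => //; apply: le_trans (cauchy_schwarz _ _) _.
by rewrite ler_wpM2r// ltW.
Qed.

Lemma orthprojP M x : subspace M -> closed M ->
  M (orthproj dot M x) /\ forall z, M z -> dot (x - orthproj dot M x) z = 0.
Proof.
move=> subM clM; exact: (xgetPex 0 (projection_exists subM clM x)).
Qed.

Lemma dot_orthproj M x z : subspace M -> closed M -> M z ->
  dot (orthproj dot M x) z = dot x z.
Proof.
move=> subM clM Mz; have [_ /(_ z Mz)] := orthprojP x subM clM.
by rewrite dotBl => /eqP; rewrite subr_eq0 => /eqP.
Qed.

Lemma orthproj_eq0 M x : subspace M -> closed M ->
  (forall z, M z -> dot z x = 0) -> orthproj dot M x = 0.
Proof.
move=> subM clM x_ort; have [Mp _] := orthprojP x subM clM.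
by apply: dot_norm_eq0; rewrite dot_orthproj//; exact: dot_eq0C (x_ort _ Mp).
Qed.

Lemma dot_lspan X x : (forall y, X y -> dot y x = 0) ->
  forall y, lspan X y -> dot y x = 0.
Proof.
move=> X_ort; apply: (smallest_sub (X := [set y | dot y x = 0])) => //.
apply/subspaceP; split=> [|a y z /= y0 z0]; first exact: dot0l.
by rewrite dotDl dotZl y0 z0 mulr0 addr0.
Qed.

(** Completeness is stated with a closure; this dual form turns it into linear
   algebra when the family is finite.  The converse projects on the closed span. *)
Lemma complete_familyP X :
  complete_family X <-> forall x, (forall y, X y -> dot y x = 0) -> x = 0.
Proof.
split=> [complX x /dot_lspan x_ort|X_sep].
  have /closureP clx : closure (lspan X) x by rewrite complX.
  apply/eqP; rewrite -normr_le0; apply/ler_addgt0Pr => eps eps_gt0.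
  have [y Xy xy] := clx eps eps_gt0; rewrite add0r.
  have [->|x_neq0] := eqVneq x 0; first by rewrite normr0 ltW.
  have x_gt0 : 0 < `|x| by rewrite normr_gt0.
  rewrite -(ler_pM2r x_gt0) -expr2.
  have -> : `|x| ^+ 2 = `|dot (x - y) x|.
    by rewrite dotBl (x_ort _ Xy) subr0 -norm_dot normrX normr_id.
  apply: le_trans (cauchy_schwarz _ _) _.
  by rewrite ler_wpM2r// ltW.
apply/seteqP; split=> // x _.
have subM := subspace_closure (subspace_lspan X).
have [Mp p_ort] := orthprojP x subM (@closed_closure _ _).
suff /eqP : x - orthproj dot (closure (lspan X)) x = 0.
  by rewrite subr_eq0 => /eqP ->.
apply: X_sep => y Xy; apply: dot_eq0C; apply: p_ort; apply: subset_closure.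
by move=> S [_]; apply.
Qed.

(** A finite family separating the points of [H] bounds the dimension: the
   coordinates against it inject [H] into a finite dimensional space. *)
Lemma separating_lin_indep_leq (T : finType) (g : T -> H) m (c : 'I_m -> H) :
  (forall x, (forall t, dot (g t) x = 0) -> x = 0) -> lin_indep c ->
  (m <= #|T|)%N.
Proof.
move=> g_sep ind_c.
apply: (lin_indep_leq (A := \matrix_(j, i) dot (c j) (g (enum_val i))) ind_c).
move=> v vA0; apply: g_sep => t; apply: dot_eq0C; rewrite dot_suml.
have /rowP/(_ (enum_rank t)) := vA0; rewrite !mxE => {2}<-.
by apply: eq_bigr => j _; rewrite mxE enum_rankK.
Qed.

(** * Coordinates in an orthonormal basis *)

Section OrthonormalBasis.
Variables (J : choiceType) (e : J -> H).
Hypothesis onb : orthonormal_basis dot e.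

Lemma onb_separates x : (forall j, dot (e j) x = 0) -> x = 0.
Proof.
by move=> ex0; apply: (complete_familyP _).1 onb.2 _ _ => _ [j _ <-].
Qed.

Lemma onb_lin_indep m (s : 'I_m -> J) :
  injective s -> lin_indep (fun i => e (s i)).
Proof.
move=> s_inj c c0 i; have := congr1 (dot^~ (e (s i))) c0.
rewrite /= dot0l dot_suml (bigD1 i)//= onb.1 eqxx mulr1 big1 ?addr0//.
by move=> j ji; rewrite onb.1 (inj_eq s_inj) (negbTE ji) mulr0.
Qed.

Lemma onb_infinite_lin_indep n : infinite_set [set: J] ->
  exists m (c : 'I_m -> H), lin_indep c /\ (n < m)%N.
Proof.
move=> /(infinite_set_fset n.+1)[B _]; rewrite cardfE => cardB.
exists #|{: B}|, (fun i => e (fsval (enum_val i))); split => //.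
by apply: onb_lin_indep => i j /val_inj/enum_val_inj.
Qed.

Lemma vdim_infinite_onb : infinite_set [set: J] -> vdim R [set: H] = +oo%E.
Proof.
move=> J_inf; apply: vdim_pinfty => -[n [b [_ b_span]]].
have [m [c [ind_c]]] := onb_infinite_lin_indep n J_inf.
have := basis_leq (b := b) ind_c.
by rewrite b_span ltnNge => -> // j.
Qed.

End OrthonormalBasis.

Lemma onb_enum (J : finType) (e : J -> H) : orthonormal_basis dot e ->
  orthonormal_basis dot (fun i : 'I_#|J| => e (enum_val i)).
Proof.
move=> [e_orth e_compl]; split=> [i j|].
  by rewrite e_orth (inj_eq enum_val_inj).
have -> // : range (fun i : 'I_#|J| => e (enum_val i)) = range e.
apply/seteqP; split=> _ [i _ <-]; first by exists (enum_val i).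
by exists (enum_rank i) => //; rewrite enum_rankK.
Qed.

Section FiniteOrthonormalBasis.
Variables (n : nat) (b : 'I_n -> H).
Hypothesis onb : orthonormal_basis dot b.

Lemma onb_coord (c : 'I_n -> K) j : dot (\sum_i c i *: b i) (b j) = c j.
Proof.
rewrite dot_suml (bigD1 j)//= onb.1 eqxx mulr1 big1 ?addr0// => i ij.
by rewrite onb.1 (negbTE ij) mulr0.
Qed.

Lemma onb_expand x : x = \sum_j dot x (b j) *: b j.
Proof.
apply/eqP; rewrite -subr_eq0; apply/eqP; apply: (onb_separates onb) => j.
by apply: dot_eq0C; rewrite dotBl onb_coord subrr.
Qed.

Lemma onb_basis : is_basis [set: H] b.
Proof.
split; first by apply: (onb_lin_indep onb (s := id)).
rewrite lspan_range; apply/seteqP; split=> // x _.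
by exists (fun j => dot x (b j)) => //; rewrite -onb_expand.
Qed.

Definition coord_mx m (g : 'I_m -> H) : 'M[K]_(m, n) :=
  \matrix_(i, j) dot (g i) (b j).

(** The pairings of [x] with the [g i] are the matrix applied to the coordinates
   of [x], so both sides say that this matrix is injective on columns. *)
Lemma separating_row_full m (g : 'I_m -> H) :
  (forall x, (forall i, dot (g i) x = 0) -> x = 0) <-> row_full (coord_mx g).
Proof.
have gE i x : dot (g i) x = \sum_j coord_mx g i j * dot (b j) x.
  by rewrite {1}[g i]onb_expand dot_suml; apply: eq_bigr => j _; rewrite mxE.
split=> [g_sep|/row_fullP[B Bg] x gx0].
  rewrite /row_full -mxrank_tr -[_ == _]/(row_free _) -kermx_eq0.
  apply/rowV0P => v /sub_kermxP v0; pose x := \sum_j conj (v 0 j) *: b j.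
  have xE j : dot (b j) x = v 0 j by rewrite dotC onb_coord scalar_conjK.
  have x0 : x = 0.
    apply: g_sep => i; have /rowP/(_ i) := v0; rewrite gE !mxE => {2}<-.
    by apply: eq_bigr => j _; rewrite xE [in RHS]mxE mulrC.
  by apply/rowP => j; rewrite -xE x0 dot0r mxE.
have u0 : coord_mx g *m (\col_j dot (b j) x) = 0.
  apply/colP => i; rewrite !mxE -[RHS](gx0 i) gE.
  by apply: eq_bigr => j _; rewrite !mxE.
apply: (onb_separates onb) => j.
have := congr1 (mulmx B) u0; rewrite mulmxA Bg mul1mx mulmx0.
by move=> /colP/(_ j); rewrite !mxE.
Qed.

(** A full-rank selection of [n] rows of the coordinate matrix is a complete
   subfamily, so all other vectors can be removed; fewer than [n] vectors never
   separate the points of [H]. *)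
Lemma frame_excess_finite (L : finType) (F : L -> H) :
  complete_family (range F) -> frame_excess R F = (#|L| - n)%:R%:E.
Proof.
move=> /complete_familyP F_sep.
have cardE (E : {fset L}) : #|` E| = #|[pred l | l \in E]|.
  by rewrite -(card_uniqP (fset_uniq E)); apply: eq_card.
apply/eqP; rewrite eq_le; apply/andP; split.
  apply: ge_ereal_sup => _ [E /complete_familyP E_sep <-].
  rewrite lee_fin ler_nat cardE.
  have n_le : (n <= #|{: {l : L | l \notin E}}|)%N.
    apply: (@separating_lin_indep_leq _ (fun l => F (val l)) _ b);
      last exact: onb_basis.1.
    move=> x Fx0; apply: E_sep => _ [l /negP lE <-]; exact: (Fx0 (Sub l lE)).
  move: n_le; rewrite card_sig => n_le.
  by rewrite -(cardC [pred l | l \in E]) -addnBA ?leq_addr.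
have full : row_full (coord_mx (fun i : 'I_#|L| => F (enum_val i))).
  apply/separating_row_full => x Fx0; apply: F_sep => _ [l _ <-].
  by rewrite -[l]enum_rankK.
apply: ereal_sup_ubound.
pose s (i : 'I_n) : L := enum_val (fullrankfun full i).
have s_inj : injective s by move=> i j /enum_val_inj/fullrankfun_inj.
exists [fset l in [predC codom s]]%fset => /=; last first.
  congr (_%:R%:E); rewrite cardE.
  rewrite -(cardC (mem (codom s))) card_codom// card_ord addKn.
  by apply: eq_card => l; rewrite !inE.
apply/complete_familyP => x Fx0.
have := fullrowsub_full full.
have -> : rowsub (fullrankfun full) (coord_mx (fun i : 'I_#|L| => F (enum_val i)))
    = coord_mx (F \o s) by apply/matrixP => i j; rewrite !mxE.
move=> /separating_row_full; apply=> i; apply: Fx0; exists (s i) => //=.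
by rewrite !inE codom_f.
Qed.

End FiniteOrthonormalBasis.

End Hilbert.

(** * Unconditional sums *)

Section UnconditionalSums.
Variables (K : numFieldType) (V : normedModType K).

Lemma has_sum_unique (I : choiceType) (x : I -> V) s t :
  has_sum x s -> has_sum x t -> s = t.
Proof.
have FF := @summability.totally_filter I.
by move=> xs xt; apply: (cvg_unique _ xs xt).
Qed.

Lemma has_sum_finite (I : finType) (x : I -> V) : has_sum x (\sum_i x i).
Proof.
have FF := @summability.totally_filter I.
apply: cvg_near_cst; exists [fset i in I]%fset => //= B /fsubsetP IB.
rewrite /summability.partial_sum.
rewrite -(big_seq_fsetE _ B xpredT x) (big_uniq _ (fset_uniq B)) /=.
by apply: eq_bigl => i; apply: IB; rewrite inE.
Qed.

Lemma has_sum0 (I : choiceType) : has_sum (fun _ : I => 0 : V) 0.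
Proof.
have FF := @summability.totally_filter I.
apply: cvg_near_cst; exists fset0 => // B _.
by rewrite /summability.partial_sum big1.
Qed.

Lemma fusion_synthesis_finite (I : finType) (w : I -> K) (f : I -> V) :
  fusion_synthesis w f = \sum_i w i *: f i.
Proof.
have FF := @summability.totally_filter I.
by apply: cvg_lim => //; exact: has_sum_finite.
Qed.

End UnconditionalSums.

(** * Fusion frames *)

Section FusionFrame.
Variables (R : realType) (k : scalar_kind).
Local Notation K := (scalars R k).
Variables (H : completeNormedModType K) (dot : {dot H for @scalar_conj R k}).
Hypothesis norm_dot : forall x : H, `|x| ^+ 2 = dot x x.

(** All the projections of such an [x] vanish, so the frame sum is [0] and the
   lower frame bound forces [x = 0]. *)
Lemma fusion_frame_separates (I : choiceType) (W : I -> set H) (w : I -> K) x :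
  is_fusion_frame dot W w -> (forall i z, W i z -> dot z x = 0) -> x = 0.
Proof.
move=> [W_sub _ _ [A [B [A_gt0 _ /(_ x)[s sum_s /andP[As _]]]]]] x_ort.
have s0 : s = 0.
  apply: has_sum_unique sum_s _.
  have -> : (fun i => w i ^+ 2 * `|orthproj dot (W i) x| ^+ 2 : K^o) = fun=> 0.
    apply/funext => i; have [subW clW] := W_sub i.
    rewrite (orthproj_eq0 norm_dot subW clW) ?normr0 ?expr0n ?mulr0//.
    exact: x_ort.
  exact: has_sum0.
move: As; rewrite s0 pmulr_rle0// => x_le0.
by apply/eqP; rewrite -normr_eq0 -sqrf_eq0 eq_le x_le0 exprn_ge0.
Qed.

(** If [x] is orthogonal to the local family, then its projection on [W i], paired
   with [e j], equals the pairing of [x] with the projection of [e j], which is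
   [0]. *)
Lemma local_family_complete (I J : choiceType) (W : I -> set H) (w : I -> K)
    (e : J -> H) : is_fusion_frame dot W w -> orthonormal_basis dot e ->
  complete_family (range (local_family dot W w e)).
Proof.
move=> fusionW onb; have [W_sub w_gt0 _ _] := fusionW.
apply/(complete_familyP norm_dot) => x Fx0.
apply: (fusion_frame_separates fusionW) => i z Wz.
have [subW clW] := W_sub i.
have [Wp p_ort] := orthprojP norm_dot x subW clW.
suff p0 : orthproj dot (W i) x = 0.
  by apply: dot_eq0C; rewrite -(dot_orthproj norm_dot x subW clW Wz) p0 dot0l.
apply: (onb_separates norm_dot onb) => j.
have /eqP := Fx0 _ (ex_intro2 _ _ (i, j) Logic.I erefl).
rewrite /local_family dotZl mulf_eq0 gt_eqF//= => /eqP pe_x.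
have [Wpe _] := orthprojP norm_dot (e j) subW clW.
rewrite -(dot_orthproj norm_dot (e j) subW clW Wp).
by apply: dot_eq0C; rewrite (dot_orthproj norm_dot)//; exact: dot_eq0C.
Qed.

(** Rank-nullity for the synthesis operator.  Coordinates in the bases [B i]
   identify the direct sum of the [W i] with row vectors indexed by the pairs of
   an [i] and an index in ['I_(d i)] ([assemble]); the synthesis operator becomes
   multiplication by the coordinate matrix of the vectors [w i *: B i l], so its
   null space corresponds to the left kernel of that matrix. *)
Section FiniteExcess.
Variables (n : nat) (b : 'I_n -> H).
Hypothesis onb : orthonormal_basis dot b.
Variables (I : finType) (W : I -> set H) (w : I -> K).
Hypothesis fusionW : is_fusion_frame dot W w.
Variables (d : I -> nat) (B : forall i, 'I_(d i) -> H).
Hypothesis basisB : forall i, is_basis (W i) (@B i).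

Let T := {i : I & 'I_(d i)}.

Let idx i (l : 'I_(d i)) : 'I_#|{: T}| :=
  enum_rank (Tagged (fun i => 'I_(d i)) l).

Let g (u : 'I_#|{: T}|) : H :=
  let t := enum_val u in w (tag t) *: B (tagged t).

Let assemble (c : 'rV[K]_#|{: T}|) (i : I) : H :=
  \sum_(l < d i) c 0 (idx l) *: B l.

Let card_T : #|{: T}| = (\sum_i d i)%N.
Proof.
rewrite -sum1_card.
rewrite -(sig_big_dep xpredT (fun i => xpredT) (fun i (l : 'I_(d i)) => 1%N)) /=.
by apply: eq_bigr => i _; rewrite sum1_card card_ord.
Qed.

(* This is where the frame property enters: the synthesis operator is onto. *)
Let g_full : row_full (coord_mx dot b g).
Proof.
apply/(separating_row_full norm_dot onb) => x gx0.
apply: (fusion_frame_separates fusionW) => i; rewrite -(basisB i).2.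
apply: dot_lspan => _ [l _ <-]; have [_ w_gt0 _ _] := fusionW.
have := gx0 (idx l).
rewrite /g /idx enum_rankK /= dotZl => /eqP.
by rewrite mulf_eq0 gt_eqF//= => /eqP.
Qed.

Let dim_leq : (n <= \sum_i d i)%N.
Proof. by rewrite -card_T -(eqP g_full) rank_leq_row. Qed.

Let synthesis_assemble c :
  fusion_synthesis w (assemble c) = \sum_u c 0 u *: g u.
Proof.
rewrite fusion_synthesis_finite.
transitivity (\sum_i \sum_(l < d i)
    c 0 (idx l) *: (w i *: B l)).
  apply: eq_bigr => i _; rewrite scaler_sumr; apply: eq_bigr => l _.
  by rewrite !scalerA mulrC.
rewrite (sig_big_dep xpredT (fun i => xpredT) (fun i (l : 'I_(d i)) =>
  c 0 (idx l) *: (w i *: B l))) /=.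
rewrite (reindex (@enum_val T predT)) /=; last exact: onW_bij (enum_val_bij _).
apply: eq_bigr => u _; rewrite /g.
by congr (c 0 _ *: _); rewrite -[RHS]enum_valK; case: (enum_val u).
Qed.

Let synthesis_assemble_eq0 c :
  fusion_synthesis w (assemble c) = 0 <-> c *m coord_mx dot b g = 0.
Proof.
have cE j : (c *m coord_mx dot b g) 0 j = dot (\sum_u c 0 u *: g u) (b j).
  by rewrite mxE dot_suml; apply: eq_bigr => u _; rewrite mxE.
rewrite synthesis_assemble; split=> [c0|c0].
  by apply/rowP => j; rewrite cE c0 dot0l mxE.
apply: (onb_separates norm_dot onb) => j; apply: dot_eq0C.
by rewrite -cE c0 mxE.
Qed.

Let assemble_inj c : assemble c = 0 -> c = 0.
Proof.
move=> c0; apply/rowP => u; rewrite mxE -[u]enum_valK.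
case: (enum_val u) => i l.
exact: ((basisB i).1 (fun l => c 0 (idx l))
  (congr1 (fun f => f i) c0) l).
Qed.

Let assemble_sum m (N : 'M[K]_(m, #|{: T}|)) (a : 'I_m -> K) :
  \sum_j a j *: assemble (row j N) = assemble ((\row_j a j) *m N).
Proof.
apply/funext => i; rewrite fct_sumE.
transitivity (\sum_j \sum_(l < d i)
    (a j * N j (idx l)) *: B l).
  apply: eq_bigr => j _; transitivity (a j *: assemble (row j N) i) => //.
  rewrite /assemble scaler_sumr.
  by apply: eq_bigr => l _; rewrite scalerA mxE.
rewrite exchange_big; apply: eq_bigr => l _ /=.
by rewrite mxE scaler_suml; apply: eq_bigr => j _; rewrite mxE.
Qed.

Let assemble_surj f : (forall i, W i (f i)) -> exists c, f = assemble c.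
Proof.
move=> Wf.
have coordB i : exists c : 'I_(d i) -> K, \sum_l c l *: B l = f i.
  have := Wf i; rewrite -(basisB i).2 lspan_range => -[c _ cf].
  by exists c.
exists (\row_u sval (cid (coordB (tag (enum_val u)))) (tagged (enum_val u))).
apply/funext => i; rewrite -{1}(svalP (cid (coordB i))); apply: eq_bigr => l _.
by rewrite mxE /idx enum_rankK.
Qed.

Lemma fusion_excess_finite :
  (n <= \sum_i d i)%N /\
  fusion_excess R W w = (\sum_i d i - n)%:R%:E.
Proof.
split; first exact: dim_leq.
pose N := row_base (kermx (coord_mx dot b g)).
rewrite -card_T -[in RHS](eqP g_full) -mxrank_ker.
apply: (vdimE R (b := fun j => assemble (row j N))); split.
  move=> a; rewrite assemble_sum => /assemble_inj a0 j.
  have : (\row_j a j) = 0.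
    apply: (row_free_inj (row_base_free (kermx (coord_mx dot b g)))).
    by rewrite a0 mul0mx.
  by move=> /rowP/(_ j); rewrite !mxE.
rewrite lspan_range; apply/seteqP; split=> [_ [a _ <-]|f [[Wf _] f0]] /=.
  rewrite assemble_sum; split; last first.
    apply/synthesis_assemble_eq0; apply/sub_kermxP.
    by rewrite (submx_trans (submxMl _ _)) ?eq_row_base.
  split; last by eexists; exact: has_sum_finite.
  move=> i; rewrite -(basisB i).2 lspan_range.
  by exists (fun l => ((\row_j a j) *m N) 0 (idx l)).
have [c fc] := assemble_surj Wf; move: f0; rewrite fc.
move=> /synthesis_assemble_eq0/sub_kermxP c_ker.
have /submxP[a ->] : (c <= N)%MS by rewrite eq_row_base.
exists (fun j => a 0 j) => //.
by rewrite assemble_sum; congr (assemble (_ *m _)); apply/rowP => j; rewrite mxE.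
Qed.

End FiniteExcess.

End FusionFrame.

(** * Finite index types *)

(** With a finite type for each index set, families over the indices become
   matrices.  The equality of countable types, rather than a bijection, lets
   every hypothesis be transported by substitution. *)
Lemma finite_countType (I : countType) :
  finite_set [set: I] -> exists T : finType, (T : countType) = I.
Proof.
case/finite_fsetP => X IX.
have enumX : Finite.axiom (enum_fset X).
  move=> x; rewrite count_uniq_mem ?fset_uniq//.
  by have : [set: I] x by []; rewrite IX /= => ->.
exists (HB.pack_for finType (Countable.sort I)
  (fintype.isFinite.Build (Countable.sort I) enumX)).
by case: I X IX enumX.
Qed.

Lemma fset_set_finType (I : finType) : fset_set [set: I] = [fset i in I]%fset.
Proof.
apply/fsetP => i; rewrite in_fset_set; last exact: finite_finset.
by rewrite mem_set// in_fset.
Qed.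

Lemma counting_finType (R : realType) (I : finType) :
  counting [set: I] = #|I|%:R%:E :> \bar R.
Proof.
rewrite /counting asboolT; last exact: finite_finset.
rewrite fset_set_finType -(card_uniqP (fset_uniq _)).
by congr (_%:R%:E); apply: eq_card => i; rewrite !inE.
Qed.

Lemma esum_finType (R : realType) (I : finType) (a : I -> nat) :
  (\esum_(i in [set: I]) (a i)%:R%:E = (\sum_i a i)%:R%:E :> \bar R)%E.
Proof.
have finI : finite_set [set: I] by exact: finite_finset.
rewrite esum_fset// fsbig_finite//=.
rewrite fset_set_finType (big_uniq _ (fset_uniq _)) /= sumEFin natr_sum.
by congr (_%:E); apply: eq_bigl => i; rewrite !inE.
Qed.

Lemma frame_excess_ge0 (R : realType) (K : numFieldType) (H : normedModType K)
    (L : choiceType) (F : L -> H) :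
  complete_family (range F) -> (0 <= frame_excess R F)%E.
Proof.
move=> F_compl; apply: ereal_sup_ubound; exists fset0; last by rewrite cardfs0.
rewrite /= (_ : ~` _ = setT)//.
by apply/seteqP; split.
Qed.

(** * The excess formula *)

Section ExcessFormula.
Variables (R : realType) (k : scalar_kind).
Local Notation K := (scalars R k).
Variables (H : completeNormedModType K) (dot : {dot H for @scalar_conj R k}).
Hypothesis norm_dot : forall x : H, `|x| ^+ 2 = dot x x.

Section InfiniteDimension.
Variables (I J : choiceType) (W : I -> set H) (w : I -> K) (e : J -> H).
Hypotheses (fusionW : is_fusion_frame dot W w).
Hypothesis finW : forall i, (vdim R (W i) < +oo)%E.
Hypothesis onb : orthonormal_basis dot e.
Hypothesis J_inf : infinite_set [set: J].

Lemma infinite_nonzero_components :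
  infinite_set [set i | vdim R (W i) != 0%E].
Proof.
move=> /finite_fsetP[X nzX]; have [d [B BP]] := finite_dim_bases finW.
pose T := {i : X & 'I_(d (val i))}.
have g_sep x :
    (forall t : T, dot (B (val (tag t)) (tagged t)) x = 0) -> x = 0.
  move=> Bx0; apply: (fusion_frame_separates norm_dot fusionW) => i.
  have [[_ Wi] di] := BP i; rewrite -Wi; apply: dot_lspan => _ [l _ <-].
  have iX : i \in X.
    have : [set i | vdim R (W i) != 0%E] i.
      rewrite /= di eqe pnatr_eq0 -lt0n.
      exact: leq_ltn_trans (ltn_ord l).
    by rewrite nzX.
  pose t : T := Tagged (fun i : X => 'I_(d (val i))) (l : 'I_(d (val [` iX]%fset))).
  exact: Bx0 t.
have [m [c [ind_c]]] := onb_infinite_lin_indep onb #|{: T}| J_inf.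
by rewrite ltnNge (separating_lin_indep_leq g_sep ind_c).
Qed.

Lemma esum_vdim_pinfty : (\esum_(i in [set: I]) vdim R (W i) = +oo)%E.
Proof.
apply: eq_infty => r.
have [X Xnz cardX] :=
  infinite_set_fset (Num.truncn r).+1 infinite_nonzero_components.
apply: esum_ge; exists [set` X]; first by split.
rewrite fsbig_finite//= set_fsetK.
apply: (@le_trans _ _ (#|` X|%:R%:E)).
  by rewrite lee_fin (le_trans (ltW (truncnS_gt r)))// ler_nat.
rewrite -sum1_size natr_sum -sumEFin big_seq [leRHS]big_seq.
apply: lee_sum => i iX.
have [n [b [_ nE]]] := vdim_lty (finW i).
by have := Xnz i iX; rewrite /= nE eqe pnatr_eq0 lee_fin ler1n lt0n.
Qed.

Lemma counting_pinfty : counting [set: I] = +oo%E :> \bar R.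
Proof.
rewrite /counting asboolF// => I_fin; apply: infinite_nonzero_components.
exact: sub_finite_set I_fin.
Qed.

End InfiniteDimension.

Lemma vdim_finite_onb (J : finType) (e : J -> H) :
  orthonormal_basis dot e -> vdim R [set: H] = #|J|%:R%:E.
Proof. by move=> onb; exact: vdimE (onb_basis norm_dot (onb_enum onb)). Qed.

Lemma excess_formula_finite (I J : finType) (W : I -> set H) (w : I -> K)
    (e : J -> H) : is_fusion_frame dot W w ->
    (forall i, (vdim R (W i) < +oo)%E) -> orthonormal_basis dot e ->
  (frame_excess R (local_family dot W w e) + \esum_(i in [set: I]) vdim R (W i)
     = counting [set: I] * vdim R [set: H] + fusion_excess R W w
   /\ frame_excess R (local_family dot W w e)
     = (counting [set: I] - 1) * vdim R [set: H])%E.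
Proof.
move=> fusionW finW onb; have onb' := onb_enum onb.
have [d [B BP]] := finite_dim_bases finW.
have [n_le ->] := fusion_excess_finite norm_dot onb' fusionW (fun i => (BP i).1).
(* If I is empty then [n_le] forces [H] to be zero. *)
have n_leI : (#|J| <= #|I| * #|J|)%N.
  have [I0|I_gt0] := posnP #|I|; last by rewrite leq_pmull.
  by move: n_le; rewrite big1 ?leqn0 => [/eqP -> //|i _]; have := fintype0 i I0.
have -> : (\esum_(i in [set: I]) vdim R (W i) = (\sum_i d i)%:R%:E)%E.
  by rewrite -esum_finType; apply: eq_esum => i _; exact: (BP i).2.
rewrite (vdim_finite_onb onb) counting_finType.
have F_compl := local_family_complete norm_dot fusionW onb.
rewrite (frame_excess_finite norm_dot onb' F_compl).
rewrite card_prod -EFinD -EFinB -!EFinM -EFinD.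
split; congr (_%:E); last by rewrite mulrBl mul1r natrB// natrM.
by rewrite -natrM -!natrD addnBA// addnBAC.
Qed.

Lemma excess_formula_infinite (I J : choiceType) (W : I -> set H) (w : I -> K)
    (e : J -> H) : is_fusion_frame dot W w ->
    (forall i, (vdim R (W i) < +oo)%E) -> orthonormal_basis dot e ->
    infinite_set [set: J] ->
  (frame_excess R (local_family dot W w e) + \esum_(i in [set: I]) vdim R (W i)
     = counting [set: I] * vdim R [set: H] + fusion_excess R W w)%E.
Proof.
move=> fusionW finW onb J_inf.
have ex_ge0 := frame_excess_ge0 R (local_family_complete norm_dot fusionW onb).
rewrite (esum_vdim_pinfty fusionW finW onb J_inf).
rewrite (counting_pinfty fusionW finW onb J_inf) (vdim_infinite_onb onb J_inf) mulyy.
have neNy (x : \bar R) : (0 <= x)%E -> x != -oo%E by case: x.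
by rewrite addey ?addye//; apply: neNy => //; exact: vdim_ge0.
Qed.

End ExcessFormula.

Local Open Scope ereal_scope.

Theorem theorem6 (R : realType) (k : scalar_kind)
    (H : completeNormedModType (scalars R k))
    (dot : {dot H for @scalar_conj R k})
    (norm_dot : forall x : H, (`|x| ^+ 2 = dot x x)%R)
    (separableH : separable_space H)
    (I J : countType) (W : I -> set H) (w : I -> scalars R k) (e : J -> H)
    (fusionW : is_fusion_frame dot W w)
    (finW : forall i, vdim R (W i) < +oo)
    (onb : orthonormal_basis dot e) :
  frame_excess R (local_family dot W w e) + \esum_(i in [set: I]) vdim R (W i)
    = counting [set: I] * vdim R [set: H] + fusion_excess R W w
  /\ (vdim R [set: H] < +oo ->
      frame_excess R (local_family dot W w e)
        = (counting [set: I] - 1) * vdim R [set: H]).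
Proof.
have [J_fin|J_inf] := pselect (finite_set [set: J]); last first.
  split; first exact: excess_formula_infinite.
  by rewrite (vdim_infinite_onb onb J_inf) ltxx.
have [J' eJ] := finite_countType J_fin; case: _ / eJ e onb {J_fin} => e onb.
have I_fin : finite_set [set: I].
  have [_ _ + _] := fusionW; apply.
  exists #|J'|, (fun i => e (enum_val i)).
  exact: (onb_basis norm_dot (onb_enum (J := J') onb)).
have [I' eI] := finite_countType I_fin.
case: _ / eI W w fusionW finW {I_fin} => W w fusionW finW.
by have [excess_eq ex] :=
  excess_formula_finite (I := I') (J := J') norm_dot fusionW finW onb.
Qed.
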